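(* Let $G$ be a connected graph with vertex set $\{v_1,\dots,v_n\}$, $n\ge 2$, and for $i=1,\dots,n$ let $H_i$ be an $r_i$-regular graph of order $p_i$ with $r_i\ge 1$. Let $\mathsf{G}=G[H_1,\dots,H_n]$, and let $n_k$ denote the order of $\mathcal{L}^k(\mathsf{G})$. Then $\mathcal{L}^k(\mathsf{G})$ has property $\varrho$ for every $k\ge 1$. Moreover, for every $k\ge 0$ and every graph $G'$ of order $n_k$ and size $m'_k$ that contains $\mathcal{L}^k(\mathsf{G})$ as a spanning subgraph, the line graph $\mathcal{L}(G')$ has property $\varrho$ and energy $\mathcal{E}(\mathcal{L}(G'))=4(m'_k-n_k)$; in particular all such line graphs $\mathcal{L}(G')$ with the same $m'_k$ are mutually equienergetic.
   Context: $G[H_1,\dots,H_n]$ ($H$-join) is obtained from the disjoint union of $H_1,\dots,H_n$ by joining every vertex of $H_i$ to every vertex of $H_j$ whenever $v_iv_j\in E(G)$. $\mathcal{L}(X)$ is the line graph; $\mathcal{L}^0=\mathrm{id}$, $\mathcal{L}^k(X)=\mathcal{L}(\mathcal{L}^{k-1}(X))$. A graph has property $\varrho$ if all its negative adjacency eigenvalues equal $-2$. Energy $\mathcal{E}(X)$ is the sum of absolute values of adjacency eigenvalues. *)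

(* Defs.v *)
From HB Require Import structures.
From mathcomp Require Import all_boot all_order all_algebra.
Set Implicit Arguments.
Unset Strict Implicit.
Unset Printing Implicit Defensive.
Import Order.TTheory GRing.Theory Num.Theory.
Local Open Scope ring_scope.

(* The vertex type may be empty, so that the line graph is total: the line
   graph of an edgeless graph has no vertex. *)
Record sgraph := SGraph {
  vertex :> finType;
  adj : rel vertex;
  adj_sym : symmetric adj;
  adj_irr : irreflexive adj }.

Definition edges (X : sgraph) : {set {set X}} :=
  [set e | [exists x : X, [exists y : X, adj x y && (e == [set x; y])]]].

Definition gorder (X : sgraph) : nat := #|X|.
Definition gsize (X : sgraph) : nat := #|edges X|.

Definition gconnected (X : sgraph) : Prop :=
  forall x y : X, connect (@adj X) x y.

Definition regular (X : sgraph) (r : nat) : Prop :=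
  forall x : X, #|[set y | adj x y]| = r.

Section GraphJoin.
Variables (G : sgraph) (H : G -> sgraph).

Definition gjoin_vertex : finType := {i : G & H i}.

(* tagged_as u v is tagged v transported to H (tag u); it is only used when
   tag u == tag v. *)
Definition gjoin_adj (u v : gjoin_vertex) : bool :=
  adj (tag u) (tag v)
  || (tag u == tag v) && adj (tagged u) (tagged_as u v).

Lemma gjoin_adj_sym : symmetric gjoin_adj.
Proof.
move=> [i x] [j y]; rewrite /gjoin_adj /= adj_sym eq_sym.
case: eqVneq => [eq_ji|] //=; case: _ / eq_ji y => y in x *.
by rewrite !tagged_asE adj_sym.
Qed.

Lemma gjoin_adj_irr : irreflexive gjoin_adj.
Proof. by move=> [i x]; rewrite /gjoin_adj /= tagged_asE !adj_irr andbF. Qed.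

Definition gjoin : sgraph := SGraph gjoin_adj_sym gjoin_adj_irr.
End GraphJoin.

Section LineGraph.
Variable X : sgraph.

Definition line_vertex : finType := {e : {set X} | e \in edges X}.

Definition line_adj (e f : line_vertex) : bool :=
  (e != f) && (val e :&: val f != set0).

Lemma line_adj_sym : symmetric line_adj.
Proof. by move=> e f; rewrite /line_adj eq_sym setIC. Qed.

Lemma line_adj_irr : irreflexive line_adj.
Proof. by move=> e; rewrite /line_adj eqxx. Qed.

Definition line_graph : sgraph := SGraph line_adj_sym line_adj_irr.
End LineGraph.

Definition iter_line (k : nat) (X : sgraph) : sgraph := iter k line_graph X.

(* X is, up to isomorphism, a spanning subgraph of Y. *)
Definition spanning_subgraph (X Y : sgraph) : Prop :=
  exists f : X -> Y, bijective f /\ forall x y : X, adj x y -> adj (f x) (f y).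

Section Spectrum.
Variables (C : numClosedFieldType) (X : sgraph).

Definition adjmx : 'M[C]_#|X| :=
  \matrix_(i, j) (adj (enum_val i) (enum_val j))%:R.

(* The roots of the (monic) characteristic polynomial, repeated according to
   their multiplicities. *)
Definition spectrum : seq C :=
  sval (closed_field_poly_normal (char_poly adjmx)).

Lemma spectrumE : char_poly adjmx = \prod_(a <- spectrum) ('X - a%:P).
Proof.
rewrite /spectrum; case: closed_field_poly_normal => s /= {1}->.
by rewrite (monicP (char_poly_monic _)) scale1r.
Qed.

Lemma mem_spectrum (a : C) : (a \in spectrum) = eigenvalue adjmx a.
Proof. by rewrite eigenvalue_root_char spectrumE root_prod_XsubC. Qed.

Definition energy : C := \sum_(a <- spectrum) `|a|.

(* In C, a < 0 means that a is real and negative. *)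
Definition property_rho : Prop :=
  forall a : C, eigenvalue adjmx a -> a < 0 -> a = - 2%:R.
End Spectrum.

Definition equienergetic (C : numClosedFieldType) (X Y : sgraph) : Prop :=
  gorder X = gorder Y /\ energy C X = energy C Y.

(* Main.v *)
(* Let X have order n and size m, and let B be its vertex-edge incidence matrix.
   Then B B^T = D + A is the signless Laplacian of X and B^T B = 2 + A(L(X)).
   If D + A >= 2, the nonzero eigenvalues of B^T B are at least 2, so an
   eigenvalue of L(X) is either -2 or nonnegative; B B^T being invertible, -2 has
   multiplicity m - n.  As A(L(X)) has trace 0, L(X) has energy 4 (m - n).
   The bound D + A >= 2 passes to spanning supergraphs.  It holds on every line
   graph of minimum degree at least 4, since there A >= -2.  On the join, split
   a vector into its mean m_i on each H_i and the deviation from it: regularity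
   bounds the part of the form inside H_i below by 2 r_i |m_i|^2 p_i, and the
   edges between the parts contribute at least the squared deviation on H_i
   times the number of outer neighbors of a vertex of H_i. *)
Require Import Defs.
From mathcomp Require Import all_boot all_order all_algebra.
From mathcomp Require Import ring.
Set Implicit Arguments.
Unset Strict Implicit.
Unset Printing Implicit Defensive.
Import Order.TTheory GRing.Theory Num.Theory.
Local Open Scope ring_scope.

Lemma det_scalar_sub_mulmxC (R : comNzRingType) (m n : nat) (a : R)
    (M : 'M[R]_(n, m)) (N : 'M[R]_(m, n)) :
  a ^+ n * \det (a%:M - N *m M) = a ^+ m * \det (a%:M - M *m N).
Proof.
(* Clear the block [N] of [W], by columns with [1%:M] or by rows with [a%:M]. *)
pose W := block_mx a%:M M N 1%:M : 'M[R]_(n + m).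
have detW : \det W = \det (a%:M - M *m N).
  have := congr1 determinant (mulmx_block a%:M M N 1%:M 1%:M 0 (- N) 1%:M).
  rewrite det_mulmx det_lblock !det1 !mulr1 => ->.
  by rewrite !mulmx1 !mul1mx !mulmx0 !add0r mulmxN subrr det_ublock det1 mulr1.
have := congr1 determinant (mulmx_block 1%:M 0 (- N) a%:M a%:M M N 1%:M).
rewrite det_mulmx det_lblock detW det1 mul1r det_scalar => ->.
rewrite !mul1mx !mul0mx !addr0 mulmx1 mulNmx mul_mx_scalar mul_scalar_mx addNr.
by rewrite det_ublock det_scalar mulNmx addrC.
Qed.

Lemma mup_char_poly_mulmx (F : fieldType) (m n : nat) (c : F)
    (M : 'M[F]_(n, m)) (N : 'M[F]_(m, n)) :
  M *m N \in unitmx -> (n + mup c (char_poly (c%:M + N *m M)))%N = m.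
Proof.
move=> MN_unit; pose a : {poly F} := 'X - c%:P.
pose q := \det (a%:M - map_mx polyC M *m map_mx polyC N).
have charpolyE : a ^+ n * char_poly (c%:M + N *m M) = a ^+ m * q.
  rewrite /q -det_scalar_sub_mulmxC; congr (_ * \det _).
  by rewrite /char_poly_mx map_mxD map_scalar_mx map_mxM opprD addrA -raddfB.
have q_nroot : ~~ root q c.
  rewrite rootE -horner_evalE -det_map_mx map_mxB map_scalar_mx /=.
  rewrite horner_evalE hornerXsubC subrr raddf0 sub0r -map_mxM -map_mx_comp.
  rewrite map_mx_id => [|x]; last by rewrite /= horner_evalE hornerC.
  by rewrite -unitfE -unitmxE -scaleN1r unitmxZ ?unitrN1.
have q_neq0 : q != 0 by apply: contraNneq q_nroot => ->; rewrite root0.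
have aX_neq0 k : a ^+ k != 0 by rewrite expf_neq0 ?polyXsubC_eq0.
have := congr1 (mup c) charpolyE.
rewrite (mupM _ (aX_neq0 n)) ?monic_neq0 ?char_poly_monic //.
rewrite (mupM _ (aX_neq0 m) q_neq0) (mupNroot q_nroot) addn0.
by rewrite !mup_XsubCX eqxx.
Qed.

Section Mean.
Variables (C : numClosedFieldType) (T : finType).
Implicit Type v : T -> C.

(* [0] when [T] is empty, as [x / 0 = 0]. *)
Definition mean v : C := (\sum_x v x) / #|T|%:R.

Definition sqnorm v : C := \sum_x `|v x| ^+ 2.

Definition sqdev v : C := sqnorm (fun x => v x - mean v).

Lemma sum_mean v : \sum_x v x = mean v *+ #|T|.
Proof.
rewrite -mulr_natr; have [T0|T_gt0] := posnP #|T|.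
  by rewrite T0 mulr0 big_pred0 // => x; have := card0_eq T0 x.
by rewrite divfK // pnatr_eq0 -lt0n.
Qed.

Lemma sqnorm_ge0 v : 0 <= sqnorm v.
Proof. by rewrite sumr_ge0 // => x _; rewrite exprn_ge0. Qed.

Lemma sqnorm_gt0 v x : v x != 0 -> 0 < sqnorm v.
Proof.
move=> vx; rewrite /sqnorm (bigD1 x) //= ltr_pwDl ?exprn_gt0 ?normr_gt0 //.
by rewrite sumr_ge0 // => y _; rewrite exprn_ge0.
Qed.

Lemma sqnorm_addl (c : C) v :
  sqnorm (fun x => c + v x) = `|c + mean v| ^+ 2 *+ #|T| + sqdev v.
Proof.
set s := c + mean v; pose d x := v x - mean v.
have sum_d : \sum_x d x = 0 by rewrite sumrB sum_mean sumr_const subrr.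
transitivity (\sum_x (`|s| ^+ 2 + s^* * d x + s * (d x)^* + `|d x| ^+ 2)).
  apply: eq_bigr => x _; have -> : c + v x = s + d x by rewrite /s /d; ring.
  by rewrite !normCK rmorphD /=; ring.
rewrite !big_split /= sumr_const -!mulr_sumr -rmorph_sum sum_d.
by rewrite raddf0 !mulr0 !addr0.
Qed.

Lemma sqnorm_mean v : sqnorm v = `|mean v| ^+ 2 *+ #|T| + sqdev v.
Proof.
by rewrite -[mean v]add0r -sqnorm_addl; apply: eq_bigr => x _; rewrite add0r.
Qed.

End Mean.

Lemma sqdev_le_sum_sqnorm (C : numClosedFieldType) (S T : finType)
    (u : S -> C) (v : T -> C) :
  sqdev u *+ #|T| + sqdev v *+ #|S| <= \sum_x \sum_y `|u x + v y| ^+ 2.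
Proof.
under eq_bigr do rewrite -/(sqnorm _) sqnorm_addl.
rewrite big_split /= sumr_const sumrMnl lerD2r lerMn2r; apply/orP; right.
under eq_bigr do rewrite addrC.
by rewrite -/(sqnorm _) sqnorm_addl lerDr mulrn_wge0 ?exprn_ge0.
Qed.

Definition degree (X : sgraph) (x : X) : nat := #|[set y | adj x y]|.

Lemma adj_neq (X : sgraph) (x y : X) : adj x y -> x != y.
Proof. by apply: contraTneq => ->; rewrite adj_irr. Qed.

Lemma ltn_degree_card (X : sgraph) (x : X) : (degree x < #|X|)%N.
Proof.
rewrite /degree -cardsT proper_card // properT.
by apply/eqP => /setP /(_ x); rewrite !inE adj_irr.
Qed.

Lemma regular_ltn_card (X : sgraph) (r : nat) :
  regular X r -> (0 < #|X|)%N -> (r < #|X|)%N.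
Proof.
by move=> X_reg /card_gt0P [x _]; rewrite -(X_reg x) ltn_degree_card.
Qed.

Lemma sum_adj_swap (V : nmodType) (X : sgraph) (F : X -> X -> V) :
  \sum_x \sum_(y | adj x y) F x y = \sum_x \sum_(y | adj x y) F y x.
Proof.
rewrite (exchange_big_dep predT) //=.
by apply: eq_bigr => y _; apply: eq_bigl => x; rewrite adj_sym.
Qed.

Lemma edgesP (X : sgraph) (e : {set X}) :
  reflect (exists x y : X, adj x y /\ e = [set x; y]) (e \in edges X).
Proof.
rewrite inE; apply: (iffP existsP) => [[x /existsP [y /andP [xy /eqP ->]]]|].
  by exists x, y.
by move=> [x [y [xy ->]]]; exists x; apply/existsP; exists y; rewrite xy eqxx.
Qed.

Lemma card_line_vertex (X : sgraph) (e : line_graph X) : #|val e| = 2%N.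
Proof. by have /edgesP [x [y [xy ->]]] := valP e; rewrite cards2 adj_neq. Qed.

Lemma card_line_vertexI (X : sgraph) (e f : line_graph X) :
  #|val e :&: val f| = ((e == f).*2 + adj e f)%N.
Proof.
rewrite /adj /= /line_adj; case: (eqVneq e f) => [->|ef] /=.
  by rewrite setIid card_line_vertex.
case: (eqVneq (val e :&: val f) set0) => [->|] /=; first by rewrite cards0.
rewrite -card_gt0 => gt0; apply/eqP; rewrite eqn_leq gt0 andbT leqNgt.
apply: contra ef => gt1; rewrite -val_eqE.
have sub_eqI (g : line_graph X) :
    val e :&: val f \subset val g -> val e :&: val f = val g.
  by move=> sub; apply/eqP; rewrite eqEcard sub card_line_vertex.
by rewrite -(sub_eqI e (subsetIl _ _)) (sub_eqI f (subsetIr _ _)).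
Qed.

Lemma gorder_line_graph (X : sgraph) : gorder (line_graph X) = gsize X.
Proof. by rewrite /gorder card_sig; apply: eq_card. Qed.

Definition neighbor_sum (V : nmodType) (X : sgraph) (v : X -> V) (x : X) : V :=
  \sum_(y | adj x y) v y.

Lemma sum_ends (V : nmodType) (X : sgraph) (v : X -> V) (x y : X) :
  adj x y -> \sum_(z in [set x; y]) v z = v x + v y.
Proof. by move=> xy; rewrite big_setU1 ?big_set1 ?inE ?adj_neq. Qed.

(* [edge_sum] and [star_sum] are the actions of [B^T] and [B], for [B] the
   vertex-edge incidence matrix of [X]. *)
Section IncidenceSums.
Variables (V : nmodType) (X : sgraph).

Definition edge_sum (v : X -> V) (e : line_graph X) : V :=
  \sum_(x in val e) v x.

Definition star_sum (w : line_graph X -> V) (x : X) : V :=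
  \sum_(e : line_graph X | x \in val e) w e.

Lemma star_sum_val (F : {set X} -> V) (x : X) :
  star_sum (F \o val) x = \sum_(y | adj x y) F [set x; y].
Proof.
rewrite /star_sum.
rewrite -(big_sub_cond (edges X) (fun e : {set X} => x \in e)).
rewrite -[RHS](big_imset _ (h := fun y => [set x; y])) /=; last first.
  move=> y z xy xz /setP /(_ y); rewrite !inE eqxx orbT.
  by rewrite eq_sym (negPf (adj_neq xy)) => /esym /eqP.
apply: eq_bigl => e; apply/andP/imsetP => [[/edgesP [a [b [ab ->]]]]|].
  rewrite !inE => /orP [] /eqP ->; first by exists b.
  by exists a; [rewrite adj_sym in ab; exact: ab | rewrite setUC].
move=> [y xy ->]; rewrite in_setU1 eqxx; split=> //.
by apply/edgesP; exists x, y.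
Qed.

Lemma sum_star_sum (F : X -> line_graph X -> V) :
  \sum_x star_sum (F x) x = \sum_e edge_sum (F^~ e) e.
Proof. exact: (exchange_big_dep predT). Qed.

Lemma sum_adj_edge (F : {set X} -> V) :
  \sum_x \sum_(y | adj x y) F [set x; y]
    = (\sum_(e : line_graph X) F (val e)) *+ 2.
Proof.
under eq_bigr do rewrite -star_sum_val.
rewrite (sum_star_sum (fun _ => F \o val)) -sumrMnl; apply: eq_bigr => e _.
by rewrite /edge_sum sumr_const card_line_vertex.
Qed.

Lemma edge_sum_star_sum (w : line_graph X -> V) (e : line_graph X) :
  edge_sum (star_sum w) e = w e *+ 2 + neighbor_sum w e.
Proof.
rewrite /edge_sum (exchange_big_dep predT) //=.
under eq_bigr => f _.
  rewrite sumr_const (_ : #|_| = #|val e :&: val f|); last first.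
    by rewrite -[RHS]cardsE; apply: eq_card => x; rewrite !inE.
  rewrite card_line_vertexI mulrnDr; over.
rewrite big_split /= (bigD1 e) //= eqxx big1 ?addr0 => [|f]; last first.
  by rewrite eq_sym => /negPf ->.
congr (_ + _); rewrite /neighbor_sum [RHS]big_mkcond; apply: eq_bigr => f _.
exact: mulrb.
Qed.

End IncidenceSums.

Lemma star_sum_edge_sum (V : nmodType) (X : sgraph) (v : X -> V) (x : X) :
  star_sum (edge_sum v) x = v x *+ degree x + neighbor_sum v x.
Proof.
rewrite (star_sum_val (fun e => \sum_(y in e) v y)) -sumr_const.
under [X in _ = X + _]eq_bigl do rewrite inE.
by rewrite -big_split; apply: eq_bigr => y xy; exact: sum_ends.
Qed.

Lemma sum_edge_sum_mul (R : pzSemiRingType) (X : sgraph) (v : X -> R)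
    (w : line_graph X -> R) :
  \sum_e edge_sum v e * w e = \sum_x v x * star_sum w x.
Proof.
under [RHS]eq_bigr do rewrite mulr_sumr.
rewrite [RHS](sum_star_sum (fun x e => v x * w e)).
by apply: eq_bigr => e _; rewrite mulr_suml.
Qed.

Lemma star_sum_cst1 (X : sgraph) (x : X) : star_sum (fun=> 1%N) x = degree x.
Proof. by rewrite (star_sum_val (fun=> 1%N)) sum1dep_card. Qed.

Lemma edge_sum_degree (X : sgraph) (e : line_graph X) :
  edge_sum (@degree X) e = (2 + degree e)%N.
Proof.
transitivity (edge_sum (star_sum (fun=> 1%N)) e).
  by apply: eq_bigr => x _; rewrite star_sum_cst1.
by rewrite edge_sum_star_sum /neighbor_sum sum1dep_card.
Qed.

Lemma sum_edge_sum (V : nmodType) (X : sgraph) (v : X -> V) :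
  \sum_e edge_sum v e = \sum_x v x *+ degree x.
Proof.
rewrite -(sum_star_sum (fun x _ => v x)); apply: eq_bigr => x _.
rewrite (star_sum_val (fun=> v x)) -sumr_const.
by apply: eq_bigl => y; rewrite inE.
Qed.

Lemma sum_degree (X : sgraph) : (\sum_(x : X) degree x = 2 * gsize X)%N.
Proof.
under eq_bigr do rewrite -star_sum_cst1.
rewrite (sum_star_sum (fun _ _ => 1%N)) -gorder_line_graph mulnC -sum_nat_const.
by apply: eq_bigr => e _; rewrite /edge_sum sum1_card card_line_vertex.
Qed.

Lemma gsize_regular (X : sgraph) (r : nat) :
  regular X r -> (gorder X * r = 2 * gsize X)%N.
Proof.
move=> X_reg; rewrite -sum_degree -sum_nat_const.
by apply: eq_bigr => x _; rewrite /degree X_reg.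
Qed.

Lemma min_degree_line_graph (X : sgraph) (d : nat) :
    (forall x : X, d < degree x)%N ->
  forall e : line_graph X, (d.*2 <= degree e)%N.
Proof.
move=> d_lt e; rewrite -(leq_add2l 2) -edge_sum_degree.
have /edgesP [x [y [xy ends_e]]] := valP e.
rewrite /edge_sum ends_e sum_ends // -[(2 + _)%N]/(d.+1).*2 -addnn.
exact: (leq_add (d_lt x) (d_lt y)).
Qed.

Lemma gconnected_adj (G : sgraph) : (2 <= gorder G)%N -> gconnected G ->
  forall i : G, exists j, adj i j.
Proof.
move=> /card_gt1P [a [b [_ _ ab]]] conn i.
have [j ij] : exists j, i != j.
  by case: (eqVneq i a) ab => [->|]; [exists b | exists a].
have /connectP [[|k s] /=] := conn i j.
  by move=> _ /eqP; rewrite eq_sym (negPf ij).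
by move=> /andP [ik _] _; exists k.
Qed.

Definition gjoin_restr (V : Type) (G : sgraph) (H : G -> sgraph)
    (v : gjoin H -> V) (i : G) : H i -> V := fun x => v (Tagged H x).
Arguments gjoin_restr {V G H} v i x.

Lemma sum_gjoin (V : nmodType) (G : sgraph) (H : G -> sgraph)
    (F : gjoin H -> V) :
  \sum_u F u = \sum_i \sum_x gjoin_restr F i x.
Proof.
rewrite (sig_big_dep _ _ (fun i (x : H i) => F (Tagged H x))) /=.
by apply: eq_bigr => -[].
Qed.

Lemma neighbor_sum_gjoin (V : nmodType) (G : sgraph) (H : G -> sgraph)
    (F : gjoin H -> V) (i : G) (x : H i) :
  neighbor_sum F (Tagged H x)
    = neighbor_sum (gjoin_restr F i) x
      + neighbor_sum (fun j => \sum_y gjoin_restr F j y) i.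
Proof.
transitivity (\sum_j \sum_(y : H j | gjoin_adj (Tagged H x) (Tagged H y))
                F (Tagged H y)).
  rewrite (sig_big_dep xpredT (fun j (y : H j) => _) (fun j (y : H j) => _)).
  by apply: eq_big => [[]|[]].
rewrite (bigD1 i) //=; congr (_ + _).
  by apply: eq_bigl => y; rewrite /gjoin_adj /= adj_irr eqxx tagged_asE.
rewrite /neighbor_sum [RHS]big_mkcond [LHS]big_mkcond; apply: eq_bigr => j _ /=.
rewrite /gjoin_adj /=; case: eqVneq => [->|ij] /=; first by rewrite adj_irr.
under eq_bigl do rewrite orbF.
by case: (adj i j); rewrite // big_pred0.
Qed.

Definition outer_degree (G : sgraph) (H : G -> sgraph) (i : G) : nat :=
  \sum_(j | adj i j) #|H j|.

Lemma degree_gjoin (G : sgraph) (H : G -> sgraph) (i : G) (x : H i) :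
  degree (Tagged H x : gjoin H) = (degree x + outer_degree H i)%N.
Proof.
rewrite /degree -!sum1dep_card.
etransitivity; first exact: (neighbor_sum_gjoin (fun=> 1%N)).
by congr (_ + _)%N; apply: eq_bigr => j _; rewrite sum1_card.
Qed.

Lemma regular_ltn_outer_degree (G : sgraph) (H : G -> sgraph) (i j : G)
    (r : nat) :
  regular (H j) r -> (0 < #|H j|)%N -> adj i j -> (r < outer_degree H i)%N.
Proof.
move=> Hj_reg Hj_gt0 ij; apply: leq_trans (regular_ltn_card Hj_reg Hj_gt0) _.
by rewrite /outer_degree (bigD1 j) //= leq_addr.
Qed.

Section RowVectors.
Variable C : numClosedFieldType.
Implicit Types S T : finType.

Definition row_of_fun T (v : T -> C) : 'rV[C]_#|T| :=
  \row_i v (enum_val i).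

Definition fun_of_row T (u : 'rV[C]_#|T|) (x : T) : C :=
  u 0 (enum_rank x).

Lemma fun_of_rowK T : cancel (@fun_of_row T) (@row_of_fun T).
Proof. by move=> u; apply/rowP => i; rewrite mxE /fun_of_row enum_valK. Qed.

Lemma row_of_funK T (v : T -> C) : fun_of_row (row_of_fun v) =1 v.
Proof. by move=> x; rewrite /fun_of_row mxE enum_rankK. Qed.

Lemma row_of_fun_mulmx S T (v : S -> C) (e : S -> T -> bool) :
  row_of_fun v *m \matrix_(i, j) (e (enum_val i) (enum_val j))%:R
    = row_of_fun (fun y => \sum_(x | e x y) v x).
Proof.
apply/rowP => j; rewrite !mxE [RHS]big_mkcond [RHS]big_enum_val.
by apply: eq_bigr => i _; rewrite !mxE mulr_natr mulrb.
Qed.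

End RowVectors.

Section SignlessLaplacian.
Variable C : numClosedFieldType.
Implicit Types X Y : sgraph.

(* The quadratic form of the signless Laplacian [D + A = B B^T]. *)
Definition signless_form X (v : X -> C) : C := sqnorm (edge_sum v).

Definition signless_ge (c : C) X : Prop :=
  forall v : X -> C, c * sqnorm v <= signless_form v.

Lemma signless_formE X (v : X -> C) :
  signless_form v = \sum_x (v x)^* * star_sum (edge_sum v) x.
Proof.
rewrite -sum_edge_sum_mul; apply: eq_bigr => e _.
by rewrite normCKC rmorph_sum.
Qed.

Lemma sqnorm_star_sum X (w : line_graph X -> C) :
  sqnorm (star_sum w) = \sum_e (w e)^* * edge_sum (star_sum w) e.
Proof.
under [RHS]eq_bigr do rewrite mulrC.
rewrite sum_edge_sum_mul; apply: eq_bigr => x _.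
by rewrite normCK rmorph_sum.
Qed.

Lemma signless_form_adj X (v : X -> C) :
  signless_form v *+ 2 = \sum_x \sum_(y | adj x y) `|v x + v y| ^+ 2.
Proof.
rewrite -(sum_adj_edge (fun e => `|\sum_(z in e) v z| ^+ 2)).
by apply: eq_bigr => x _; apply: eq_bigr => y xy; rewrite sum_ends.
Qed.

Lemma signless_ge_spanning c X Y :
  spanning_subgraph X Y -> signless_ge c X -> signless_ge c Y.
Proof.
move=> [f [bij_f adj_f]] Xge v.
rewrite /sqnorm (reindex f (onW_bij _ bij_f)) /=.
apply: le_trans (Xge (v \o f)) _; rewrite -(ler_pMn2r (ltn0Sn 1)).
rewrite !signless_form_adj [leRHS](reindex f (onW_bij _ bij_f)) /=.
apply: ler_sum => x _; rewrite [leRHS](reindex f (onW_bij _ bij_f)) /=.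
rewrite big_mkcond [leRHS]big_mkcond; apply: ler_sum => y _ /=.
case: ifP => [/adj_f -> //|_].
by case: ifP => // _; rewrite exprn_ge0.
Qed.

(* [B^T B] is positive and equals [2 + A], so [D + A >= D - 2]. *)
Lemma signless_ge_line_graph X (d : nat) :
    (forall e : line_graph X, d <= degree e)%N ->
  signless_ge (d%:R - 2%:R) (line_graph X).
Proof.
move=> d_le v; suff formE : signless_form v
    = \sum_e ((degree e)%:R - 2%:R) * `|v e| ^+ 2 + sqnorm (star_sum v).
  rewrite formE mulr_sumr -[leLHS]addr0 lerD ?sqnorm_ge0 //.
  apply: ler_sum => e _; rewrite ler_wpM2r ?exprn_ge0 //.
  by rewrite lerD2r ler_nat.
rewrite signless_formE sqnorm_star_sum -big_split; apply: eq_bigr => e _ /=.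
rewrite edge_sum_star_sum star_sum_edge_sum normCK -mulr_natr; ring.
Qed.

Lemma mean_edge_sum X (r : nat) (v : X -> C) : regular X r -> (0 < gsize X)%N ->
  mean (edge_sum v) = mean v *+ 2.
Proof.
rewrite -gorder_line_graph => X_reg L_gt0; rewrite {1}/mean sum_edge_sum.
under eq_bigr => x do rewrite [degree x]X_reg.
rewrite sumrMnl sum_mean -mulrnA [(_ * r)%N](gsize_regular X_reg) mulrnA.
rewrite -(gorder_line_graph X) -[_ *+ gorder _]mulr_natr mulfK //.
by rewrite pnatr_eq0 -lt0n.
Qed.

Lemma signless_form_regular_ge X (r : nat) (v : X -> C) : regular X r ->
  (2 * r)%:R * (`|mean v| ^+ 2 *+ #|X|) <= signless_form v.
Proof.
move=> X_reg.
have -> : (2 * r)%:R * (`|mean v| ^+ 2 *+ #|X|)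
    = `|mean v *+ 2| ^+ 2 *+ gsize X.
  rewrite normrMn exprMn_n mulr_natl -!mulrnA; congr (_ *+ _).
  by rewrite mulnCA [(_ * r)%N](gsize_regular X_reg) mulnA.
have [->|L_gt0] := posnP (gsize X); first by rewrite sqnorm_ge0.
rewrite -(mean_edge_sum v X_reg L_gt0) -gorder_line_graph.
by rewrite /signless_form sqnorm_mean lerDl sqnorm_ge0.
Qed.

Lemma signless_form_gjoin (G : sgraph) (H : G -> sgraph) (v : gjoin H -> C) :
  signless_form v *+ 2 = (\sum_i signless_form (gjoin_restr v i)) *+ 2
    + \sum_i \sum_(j | adj i j) \sum_x \sum_y
        `|gjoin_restr v i x + gjoin_restr v j y| ^+ 2.
Proof.
rewrite signless_form_adj sum_gjoin -sumrMnl -big_split /=.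
apply: eq_bigr => i _; rewrite signless_form_adj exchange_big -big_split /=.
apply: eq_bigr => x _.
exact: (neighbor_sum_gjoin (fun u => `|v (Tagged H x) + v u| ^+ 2)).
Qed.

Lemma signless_ge_gjoin (c : C) (G : sgraph) (H : G -> sgraph) (r : G -> nat) :
    (forall i, regular (H i) (r i)) -> (forall i, c <= (2 * r i)%:R) ->
    (forall i, c <= (outer_degree H i)%:R) ->
  signless_ge c (gjoin H).
Proof.
move=> H_reg c_r c_outer v; rewrite -(ler_pMn2r (ltn0Sn 1)) signless_form_gjoin.
set u := gjoin_restr v.
have cross_ge : (\sum_i sqdev (u i) *+ outer_degree H i) *+ 2
    <= \sum_i \sum_(j | adj i j) \sum_x \sum_y `|u i x + u j y| ^+ 2.
  under eq_bigr do rewrite -sumrMnr.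
  rewrite mulr2n [X in _ + X]sum_adj_swap -big_split; apply: ler_sum => i _ /=.
  rewrite -big_split; apply: ler_sum => j _; exact: sqdev_le_sum_sqnorm.
apply: le_trans (lerD (lexx _) cross_ge); rewrite -mulrnDl lerMn2r /=.
rewrite {1}/sqnorm sum_gjoin mulr_sumr -big_split; apply: ler_sum => i _ /=.
rewrite -/(sqnorm (u i)) sqnorm_mean mulrDr lerD //.
  apply: le_trans (signless_form_regular_ge (u i) (H_reg i)).
  by rewrite ler_wpM2r // mulrn_wge0 ?exprn_ge0.
by rewrite -mulr_natl ler_wpM2r ?sqnorm_ge0.
Qed.

Definition incidence_mx X : 'M[C]_(#|X|, #|line_graph X|) :=
  \matrix_(i, j) (enum_val i \in val (enum_val j : line_graph X))%:R.

Lemma row_of_fun_adjmx X (v : X -> C) :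
  row_of_fun v *m adjmx C X = row_of_fun (neighbor_sum v).
Proof.
rewrite row_of_fun_mulmx; apply/rowP => j; rewrite !mxE.
by apply: eq_bigl => x; rewrite adj_sym.
Qed.

Lemma row_of_fun_incidence X (v : X -> C) :
  row_of_fun v *m incidence_mx X = row_of_fun (edge_sum v).
Proof. exact: row_of_fun_mulmx. Qed.

Lemma row_of_fun_tr_incidence X (w : line_graph X -> C) :
  row_of_fun w *m (incidence_mx X)^T = row_of_fun (star_sum w).
Proof.
rewrite -(row_of_fun_mulmx w (fun e x => x \in val e)).
by congr (_ *m _); apply/matrixP => i j; rewrite !mxE.
Qed.

Lemma tr_incidence_mul X :
  (incidence_mx X)^T *m incidence_mx X = 2%:R%:M + adjmx C (line_graph X).
Proof.
apply/eqP/mulmxP => u; rewrite -[u]fun_of_rowK; set w := fun_of_row u.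
rewrite mulmxA row_of_fun_tr_incidence row_of_fun_incidence mulmxDr.
rewrite mul_mx_scalar row_of_fun_adjmx; apply/rowP => i; rewrite !mxE.
by rewrite edge_sum_star_sum mulr_natl.
Qed.

Lemma eigenvector_adjmx X (a : C) : eigenvalue (adjmx C X) a ->
  exists2 v : X -> C, exists x, v x != 0 & forall x, neighbor_sum v x = a * v x.
Proof.
move=> /eigenvalueP [u uA /rV0Pn [i ui]]; exists (fun_of_row u) => [|x].
  by exists (enum_val i); rewrite /fun_of_row enum_valK.
rewrite -[LHS](row_of_funK (neighbor_sum _)) -row_of_fun_adjmx fun_of_rowK uA.
by rewrite /fun_of_row mxE.
Qed.

Lemma incidence_mul_tr_unit c X : 0 < c -> signless_ge c X ->
  incidence_mx X *m (incidence_mx X)^T \in unitmx.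
Proof.
move=> c_gt0 Xge; rewrite -row_free_unit; apply: inj_row_free => u.
rewrite -[u]fun_of_rowK; set v := fun_of_row u.
rewrite mulmxA row_of_fun_incidence row_of_fun_tr_incidence => star_edge_row0.
have star_edge0 x : star_sum (edge_sum v) x = 0.
  by rewrite -[LHS](row_of_funK (star_sum _)) star_edge_row0 /fun_of_row mxE.
apply/rowP => i; rewrite !mxE; apply: contraTeq (Xge v) => /sqnorm_gt0 v_gt0.
rewrite signless_formE big1 => [|x _]; last by rewrite star_edge0 mulr0.
by rewrite lt_geF // mulr_gt0.
Qed.

Lemma size_spectrum X : size (spectrum C X) = #|X|.
Proof.
apply/eqP; rewrite -eqSS -(size_char_poly (adjmx C X)) spectrumE.
by rewrite size_prod_XsubC.
Qed.

Lemma sum_spectrum X : \sum_(a <- spectrum C X) a = 0.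
Proof.
have [X0|X_gt0] := posnP #|X|.
  by move: (size_spectrum X); rewrite X0 => /size0nil ->; rewrite big_nil.
have := char_poly_trace (adjmx C X) X_gt0.
rewrite spectrumE -{1}size_spectrum coefPn_prod_XsubC ?size_spectrum -?lt0n //.
move/oppr_inj ->; rewrite /mxtrace big1 // => i _.
by rewrite mxE adj_irr.
Qed.

Lemma count_spectrum X (a : C) :
  count_mem a (spectrum C X) = mup a (char_poly (adjmx C X)).
Proof. by rewrite spectrumE mu_prod_XsubC. Qed.

Lemma count_neg2_line_graph c X : 0 < c -> signless_ge c X ->
  (gorder X + count_mem (- 2%:R : C) (spectrum C (line_graph X)))%N = gsize X.
Proof.
move=> c_gt0 Xge; rewrite count_spectrum -gorder_line_graph.
have -> : adjmx C (line_graph X)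
    = (- 2%:R)%:M + (incidence_mx X)^T *m incidence_mx X.
  by rewrite tr_incidence_mul addrA -raddfD addNr raddf0 add0r.
exact: mup_char_poly_mulmx (incidence_mul_tr_unit c_gt0 Xge).
Qed.

Lemma eigenvalue_line_graph c X (a : C) : signless_ge c X ->
  eigenvalue (adjmx C (line_graph X)) a -> a = - 2%:R \/ c - 2%:R <= a.
Proof.
move=> Xge /eigenvector_adjmx [v [e /sqnorm_gt0 v_gt0] eig]; set b := a + 2%:R.
have edge_star f : edge_sum (star_sum v) f = b * v f.
  by rewrite edge_sum_star_sum eig mulrDl mulr_natl addrC.
have sqnorm_star : sqnorm (star_sum v) = b * sqnorm v.
  rewrite sqnorm_star_sum mulr_sumr; apply: eq_bigr => f _.
  by rewrite edge_star mulrCA -normCKC.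
have b_ge0 : 0 <= b by rewrite -(pmulr_lge0 _ v_gt0) -sqnorm_star sqnorm_ge0.
have form_star_sum : signless_form (star_sum v) = b ^+ 2 * sqnorm v.
  rewrite /signless_form /sqnorm mulr_sumr; apply: eq_bigr => f _.
  by rewrite edge_star normrM exprMn ger0_norm.
have := Xge (star_sum v).
rewrite sqnorm_star form_star_sum mulrA ler_pM2r // expr2.
have [/eqP|b_neq0] := eqVneq b 0.
  by rewrite addr_eq0 => /eqP ->; left.
by rewrite ler_pM2r ?lt0r ?b_neq0 // lerBlDr; right.
Qed.

Lemma property_rho_line_graph X :
  signless_ge 2%:R X -> property_rho C (line_graph X).
Proof.
move=> Xge a /(eigenvalue_line_graph Xge) [] //.
by rewrite subrr => /le_gtF ->.
Qed.

Lemma energy_line_graph X : signless_ge 2%:R X ->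
  energy C (line_graph X) = 4%:R * ((gsize X)%:R - (gorder X)%:R).
Proof.
move=> Xge; have normE a : a \in spectrum C (line_graph X) ->
    `|a| = a + (4 * (a == - 2%:R))%:R.
  rewrite mem_spectrum => /(eigenvalue_line_graph Xge) [->|].
    by rewrite eqxx normrN ger0_norm ?ler0n // muln1 (natrD _ 2 2) addKr.
  rewrite subrr => a_ge0; rewrite ger0_norm // (_ : _ == _ = false) ?addr0 //.
  by apply: contraTF a_ge0 => /eqP ->; rewrite oppr_ge0 lern0.
rewrite /energy (eq_big_seq _ normE) big_split /= sum_spectrum add0r -natr_sum.
rewrite -big_distrr /= natrM; congr (_ * _).
rewrite -(count_neg2_line_graph _ Xge) ?ltr0n // natrD addrAC subrr add0r.
by rewrite -sum1_count [in RHS]big_mkcond; congr _%:R.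
Qed.

Lemma equienergetic_line_graph X Y :
    signless_ge 2%:R X -> signless_ge 2%:R Y ->
    gorder X = gorder Y -> gsize X = gsize Y ->
  equienergetic C (line_graph X) (line_graph Y).
Proof.
move=> Xge Yge eq_order eq_size; rewrite /equienergetic !gorder_line_graph.
by rewrite !energy_line_graph // eq_order eq_size.
Qed.

Lemma signless_ge2_iter_line X (k : nat) :
    signless_ge 2%:R X -> (forall x : X, 3 <= degree x)%N ->
  signless_ge 2%:R (iter_line k X).
Proof.
move=> Xge X_deg.
have deg_ge3 j (x : iter_line j X) : (3 <= degree x)%N.
  elim: j x => [|j IHj] x //.
  exact: ltnW (min_degree_line_graph IHj x).
case: k => [//|k]; rewrite -[2%:R](addrK 2%:R) -natrD.
exact: signless_ge_line_graph (min_degree_line_graph (@deg_ge3 k)).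
Qed.

End SignlessLaplacian.

Theorem theorem4p6 (C : numClosedFieldType) (G : sgraph) (H : G -> sgraph)
    (r p : G -> nat)
    (hn : (2 <= gorder G)%N) (hG : gconnected G)
    (hp : forall i : G, gorder (H i) = p i)
    (hp0 : forall i : G, (1 <= p i)%N)
    (hr : forall i : G, regular (H i) (r i))
    (hr1 : forall i : G, (1 <= r i)%N) :
  let GG := gjoin H in
  let n_ (k : nat) := gorder (iter_line k GG) in
  [/\ forall k : nat, (1 <= k)%N -> property_rho C (iter_line k GG),
      forall (k m' : nat) (G' : sgraph),
        gorder G' = n_ k -> gsize G' = m' ->
        spanning_subgraph (iter_line k GG) G' ->
        property_rho C (line_graph G') /\
        energy C (line_graph G') = 4%:R * (m'%:R - (n_ k)%:R)
    & forall (k m' : nat) (G' G'' : sgraph),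
        gorder G' = n_ k -> gsize G' = m' ->
        spanning_subgraph (iter_line k GG) G' ->
        gorder G'' = n_ k -> gsize G'' = m' ->
        spanning_subgraph (iter_line k GG) G'' ->
        equienergetic C (line_graph G') (line_graph G'')].
Proof.
move=> GG n_.
have outer_gt1 i : (1 < outer_degree H i)%N.
  have [j ij] := gconnected_adj hn hG i.
  apply: leq_ltn_trans (hr1 j) (regular_ltn_outer_degree (hr j) _ ij).
  by rewrite -/(gorder (H j)) hp.
have GG_deg (u : GG) : (3 <= degree u)%N.
  case: u => i x; rewrite degree_gjoin.
  by apply: (leq_add (_ : 1 <= _)%N (outer_gt1 i)); rewrite [degree x]hr.
have GG_ge2 : signless_ge (2%:R : C) GG.
  apply: (signless_ge_gjoin hr) => i; rewrite ler_nat //.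
  by rewrite -{1}[2%N]muln1 leq_mul2l hr1.
have iter_ge2 k : signless_ge (2%:R : C) (iter_line k GG).
  exact: signless_ge2_iter_line GG_ge2 GG_deg.
have span_ge2 k G' :
    spanning_subgraph (iter_line k GG) G' -> signless_ge (2%:R : C) G'.
  by move=> /signless_ge_spanning; apply.
split=> [[//|k] _ | k m' G' <- <- /span_ge2 ge2' |].
- exact: property_rho_line_graph (iter_ge2 k).
- by split; [exact: property_rho_line_graph | exact: energy_line_graph].
- move=> k m' G' G'' <- <- /span_ge2 ge2' n_eq m_eq /span_ge2 ge2''.
  exact: equienergetic_line_graph.
Qed.
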